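(* Let $(p_n,q_n)_{n\ge 0}$ be any sequence of pairs of real numbers with $0\le p_n,q_n\le 1$, and let $\mu$ be the Borel probability measure on $\mathbb K=\{0,1\}^{\mathbb N}$ defined by the non-homogeneous Markov rule described in the context. Then $$\dim_*(\mu)=\dim^*(\mu)=h_*(\mu)\qquad\text{and}\qquad \mathrm{Dim}_*(\mu)=\mathrm{Dim}^*(\mu)=h^*(\mu).$$
   Context: $\mathbb K=\{0,1\}^{\mathbb N}$ is the dyadic Cantor set (limit set of the dyadic tree) with the metric in which the cylinder $I_{\epsilon_1\dots\epsilon_n}=\{x\in\mathbb K: x_1=\epsilon_1,\dots,x_n=\epsilon_n\}$ ($\epsilon_i\in\{0,1\}$) has diameter $2^{-n}$. $\mathcal F_n$ denotes the set of cylinders of generation $n$ ($\mathcal F_0=\{\mathbb K\}$). For $x\in\mathbb K$, $I_n(x)$ is the cylinder of $\mathcal F_n$ containing $x$. The measure $\mu$: $\mu(I_0)=p_0$, $\mu(I_1)=1-p_0$, and for $n\ge1$, every $I=I_{\epsilon_1\dots\epsilon_n}$ and $\epsilon_{n+1}\in\{0,1\}$, writing $IJ=I_{\epsilon_1\dots\epsilon_n\epsilon_{n+1}}$, $$\mu(IJ)=\mu(I)\cdot\begin{cases} p_n\mathbf 1_{\{\epsilon_{n+1}=0\}}+(1-p_n)\mathbf 1_{\{\epsilon_{n+1}=1\}} & \text{if } \epsilon_n=0,\\ q_n\mathbf 1_{\{\epsilon_{n+1}=0\}}+(1-q_n)\mathbf 1_{\{\epsilon_{n+1}=1\}} & \text{if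 } \epsilon_n=1.\end{cases}$$ Entropies (with convention $0\log 0=0$): $h_*(\mu)=\liminf_{n\to\infty}\frac{-1}{n\log 2}\sum_{I\in\mathcal F_n}\mu(I)\log\mu(I)$ and $h^*(\mu)=\limsup_{n\to\infty}\frac{-1}{n\log 2}\sum_{I\in\mathcal F_n}\mu(I)\log\mu(I)$. Dimensions of the measure: $\dim_*(\mu)=\inf\{\dim_{\mathcal H}E: E\subset\mathbb K,\ \mu(E)>0\}$, $\dim^*(\mu)=\inf\{\dim_{\mathcal H}E: E\subset\mathbb K,\ \mu(\mathbb K\setminus E)=0\}$, $\mathrm{Dim}_*(\mu)=\inf\{\dim_{\mathcal P}E: \mu(E)>0\}$, $\mathrm{Dim}^*(\mu)=\inf\{\dim_{\mathcal P}E:\mu(\mathbb K\setminus E)=0\}$, where $\dim_{\mathcal H}$ is Hausdorff dimension and $\dim_{\mathcal P}$ is packing (Tricot) dimension. *)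

(* Defs.v *)
From HB Require Import structures.
From mathcomp Require Import all_boot all_order all_algebra.
From mathcomp Require Import all_classical all_reals all_analysis.
Set Implicit Arguments. Unset Strict Implicit. Unset Printing Implicit Defensive.
Import Order.TTheory GRing.Theory Num.Theory.
Local Open Scope classical_set_scope.
Local Open Scope ring_scope.

(** The dyadic Cantor set K = {0,1}^N ; the coordinate x i (i = 0,1,...)
    is the paper's x_{i+1}; [false] encodes 0 and [true] encodes 1. *)
Definition Kt := nat -> bool.

Definition cyl (w : seq bool) : set Kt :=
  [set x | forall i, (i < size w)%N -> x i = nth false w i].

Definition cylinders : set (set Kt) := range cyl.

(** Borel sigma-algebra of K (generated by the cylinders, which form a
    countable clopen base of the topology). *)
Definition KM := g_sigma_algebraType cylinders.

Section Geometry.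
Variable R : realType.

(** the metric: d(x,y) = 2^{-k}, k the first index where x and y differ
    (so that a cylinder of generation n has diameter 2^{-n}); d(x,x)=0 *)
Definition dK (x y : Kt) : R := sup [set (2^-1) ^+ k | k in [set k | x k != y k]].

Definition diamK (U : set Kt) : R :=
  sup [set r | exists x y, U x /\ U y /\ r = dK x y].

Definition diam_pow (s : R) (U : set Kt) : \bar R :=
  if `[< U !=set0 >] then (powR (diamK U) s)%:E else 0%E.

Definition hausdorff_delta (s delta : R) (E : set Kt) : \bar R :=
  ereal_inf [set (\sum_(i <oo) diam_pow s (U i))%E | U in
    [set U : nat -> set Kt | E `<=` \bigcup_i U i /\ forall i, diamK (U i) <= delta]].

Definition hausdorff (s : R) (E : set Kt) : \bar R :=
  ereal_sup [set hausdorff_delta s delta E | delta in [set delta : R | 0 < delta]].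

Definition dimH (E : set Kt) : \bar R :=
  ereal_inf [set s%:E | s in [set s : R | 0 <= s /\ hausdorff s E = 0%E]].

Definition ballK (x : Kt) (r : R) : set Kt := [set y | dK x y <= r].

Definition packing (delta : R) (E : set Kt) (P : seq (Kt * R)) : Prop :=
  (forall b, b \in P -> E b.1 /\ 0 < b.2 <= delta) /\
  (forall i j, (i < size P)%N -> (j < size P)%N -> i <> j ->
     ballK (nth (fun _ => false, 0) P i).1 (nth (fun _ => false, 0) P i).2
     `&` ballK (nth (fun _ => false, 0) P j).1 (nth (fun _ => false, 0) P j).2 = set0).

Definition packing_delta (s delta : R) (E : set Kt) : \bar R :=
  ereal_sup [set (\sum_(b <- P) (powR (2 * b.2) s)%:E)%E | P in
    [set P | packing delta E P]].

Definition packing_pre (s : R) (E : set Kt) : \bar R :=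
  ereal_inf [set packing_delta s delta E | delta in [set delta : R | 0 < delta]].

Definition packing_measure (s : R) (E : set Kt) : \bar R :=
  ereal_inf [set (\sum_(i <oo) packing_pre s (F i))%E | F in
    [set F : nat -> set Kt | E `<=` \bigcup_i F i]].

Definition dimP (E : set Kt) : \bar R :=
  ereal_inf [set s%:E | s in [set s : R | 0 <= s /\ packing_measure s E = 0%E]].

End Geometry.

Section MarkovMeasure.
Variable R : realType.

Definition markov_factor (p q : nat -> R) (w : seq bool) (i : nat) : R :=
  let param := if i == 0%N then p 0%N
               else if nth false w i.-1 then q i else p i in
  if nth false w i then 1 - param else param.

Definition markov_cyl (p q : nat -> R) (w : seq bool) : R :=
  \prod_(i < size w) markov_factor p q w i.

Definition xlogx (x : R) : R := if x == 0 then 0 else x * ln x.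

Definition entropy_n (mu : set KM -> \bar R) (n : nat) : R :=
  - (\sum_(w : n.-tuple bool) xlogx (fine (mu (cyl w)))) / (n%:R * ln 2).

Definition h_lower (mu : set KM -> \bar R) : \bar R :=
  limn_einf (fun n => (entropy_n mu n)%:E).
Definition h_upper (mu : set KM -> \bar R) : \bar R :=
  limn_esup (fun n => (entropy_n mu n)%:E).

Definition dim_lower (mu : set KM -> \bar R) : \bar R :=
  ereal_inf [set dimH R E | E in [set E : set KM | measurable E /\ (0 < mu E)%E]].
Definition dim_upper (mu : set KM -> \bar R) : \bar R :=
  ereal_inf [set dimH R E | E in [set E : set KM | measurable E /\ mu (~` E) = 0%E]].
Definition Dim_lower (mu : set KM -> \bar R) : \bar R :=
  ereal_inf [set dimP R E | E in [set E : set KM | measurable E /\ (0 < mu E)%E]].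
Definition Dim_upper (mu : set KM -> \bar R) : \bar R :=
  ereal_inf [set dimP R E | E in [set E : set KM | measurable E /\ mu (~` E) = 0%E]].

End MarkovMeasure.

(* Main.v *)
Require Import Defs.
From HB Require Import structures.
From mathcomp Require Import all_boot all_order all_algebra.
From mathcomp Require Import all_classical all_reals all_analysis.
From mathcomp Require Import ring lra.
Import Order.TTheory GRing.Theory Num.Theory.
Import numFieldNormedType.Exports.
Local Open Scope classical_set_scope.
Local Open Scope ring_scope.
Set Implicit Arguments. Unset Strict Implicit. Unset Printing Implicit Defensive.

(** Let [L_n(x) = - log mu(I_n(x))], with mean [H_n]. Conditioning backwards on the chain,
    the variance of [L_n] is controlled by the gap [D_k] between the conditional entropies
    of the coordinates [k, ..., n-1] given either value of coordinate [k-1]. Binary entropy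
    is so small near [0] and [1] that [D_k^2 <= 10 + |p_k - q_k| D_(k+1)^2], while [D_(k+1)]
    contributes at most [2 (1 - |p_k - q_k|) D_(k+1)^2] to the variance: the sum telescopes
    and [Var L_n <= 52 n] without any mixing assumption. Hence [L_n - H_n = o(n)] almost
    surely: Chebyshev and Borel-Cantelli along the squares, then monotonicity of [L_n].
    So the lower and upper local dimensions of [mu] are almost everywhere the constants
    [h_*] and [h^*], and they determine its Hausdorff and packing dimensions. *)

(** * Information variance *)

Section BinaryEntropy.
Variable R : realType.

Lemma ln_le_subr1 (x : R) : 0 < x -> ln x <= x - 1.
Proof. by move=> x0; have := @le_ln1Dx R (x - 1); rewrite addrCA subrr addr0; apply; lra. Qed.

(** With [x = y ^+ 2] the left side is [4 * (y * ln y) ^+ 2], and [ln y^-1 <= y^-1 - 1] gives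
    [- (y * ln y) <= 1]. *)
Lemma mulr_ln_sqr_le (x : R) : 0 <= x <= 1 -> x * ln x ^+ 2 <= 4.
Proof.
case/andP; rewrite le_eqVlt => /orP[/eqP<- _|x0 x1]; first by rewrite mul0r; lra.
set y := Num.sqrt x.
have y0 : 0 < y by rewrite sqrtr_gt0.
have xy : x = y ^+ 2 by rewrite sqr_sqrtr // ltW.
have y1 : y <= 1 by move: x1; rewrite xy; nra.
have := @ln_le_subr1 (y^-1); rewrite invr_gt0 y0 lnV ?posrE // => /(_ isT) h.
have lny : ln y <= 0 by apply: ln_le0.
have h2 : - (y * ln y) <= 1.
  have : y * (- ln y) <= y * (y^-1 - 1) by rewrite ler_pM2l.
  by rewrite mulrBr divff ?gt_eqF // mulr1 mulrN; lra.
have -> : ln x = ln y *+ 2 by rewrite xy lnXn.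
have -> : x * (ln y *+ 2) ^+ 2 = 4 * (- (y * ln y)) ^+ 2.
  by rewrite xy -mulr_natl; ring.
have : 0 <= - (y * ln y) by nra.
nra.
Qed.

Lemma Nmulr_ln_ge0 (x : R) : 0 <= x <= 1 -> 0 <= - (x * ln x).
Proof. by move=> /andP[x0 x1]; have := ln_le0 x1; nra. Qed.

Lemma Nmulr_ln_le (x : R) : 0 <= x <= 1 -> - (x * ln x) <= 1 - x.
Proof.
case/andP; rewrite le_eqVlt => /orP[/eqP<- _|x0 x1]; first by rewrite mul0r; lra.
have := @ln_le_subr1 (x^-1); rewrite invr_gt0 x0 lnV ?posrE // => /(_ isT) h.
have : x * (- ln x) <= x * (x^-1 - 1) by rewrite ler_pM2l.
by rewrite mulrBr divff ?gt_eqF // mulr1 mulrN.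
Qed.

Definition binary_entropy (x : R) : R := - (x * ln x) - (1 - x) * ln (1 - x).

Lemma binary_entropyC (x : R) : binary_entropy (1 - x) = binary_entropy x.
Proof.
rewrite /binary_entropy; have -> : 1 - (1 - x) = x by ring.
ring.
Qed.

Lemma binary_entropy_ge0 (x : R) : 0 <= x <= 1 -> 0 <= binary_entropy x.
Proof.
move=> x01; have := Nmulr_ln_ge0 x01; have := @Nmulr_ln_ge0 (1 - x).
rewrite /binary_entropy; move: x01 => /andP[x0 x1] /(_ _)/[swap] h.
by case: (@idP (0 <= 1 - x <= 1)) => [_ /(_ isT)|[]]; lra.
Qed.

(** The two terms of the entropy are nonnegative, the first with square at most [4 * x] and the
    second at most [x]; then [(A + B) ^+ 2 <= 2 * A ^+ 2 + 2 * B ^+ 2] gives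
    [8 * x + 2 * x ^+ 2]. *)
Lemma binary_entropy_sqr_le (x : R) : 0 <= x <= 1 -> binary_entropy x ^+ 2 <= 10 * x.
Proof.
move=> x01; have h0 := Nmulr_ln_ge0 x01.
have x01' : 0 <= 1 - x <= 1 by lra.
have := Nmulr_ln_le x01'; have := Nmulr_ln_ge0 x01'.
have := mulr_ln_sqr_le x01; rewrite /binary_entropy.
move: x01 => /andP[x0 x1].
set a := ln x in h0 *; set b := (1 - x) * _.
have -> : 1 - (1 - x) = x by ring.
move=> ha hb1 hb2.
have : (x * a) ^+ 2 <= 4 * x.
  have -> : (x * a) ^+ 2 = (x * a ^+ 2) * x by ring.
  by rewrite ler_wpM2r.
nra.
Qed.

Lemma binary_entropy_le (x : R) : 0 <= x <= 1 -> binary_entropy x <= 4.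
Proof.
move=> x01; have := binary_entropy_sqr_le x01; have := binary_entropy_ge0 x01.
by move: x01 => /andP[_ x1]; nra.
Qed.

(** The difference of two nonnegative numbers is at most the larger one. If [x >= y], then
    [1 - |x - y|] is [(1 - x) + y], which dominates [1 - x] for the first entropy and [y] for the
    second; the other case is symmetric. *)
Lemma binary_entropy_gap (x y : R) : 0 <= x <= 1 -> 0 <= y <= 1 ->
  (binary_entropy x - binary_entropy y) ^+ 2 <= 10 * (1 - `|x - y|).
Proof.
move=> x01 y01.
have x01' : 0 <= 1 - x <= 1 by lra.
have y01' : 0 <= 1 - y <= 1 by lra.
have := binary_entropy_sqr_le x01; have := binary_entropy_sqr_le y01.
have := binary_entropy_sqr_le x01'; have := binary_entropy_sqr_le y01'.
rewrite !binary_entropyC.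
have := binary_entropy_ge0 x01; have := binary_entropy_ge0 y01.
set a := binary_entropy x; set b := binary_entropy y => b0 a0 b2 a2 b1 a1.
have : (a - b) ^+ 2 <= Num.max (a ^+ 2) (b ^+ 2).
  by rewrite le_max; have [ab|ab] := leP a b; apply/orP; [right|left]; nra.
move=> /le_trans; apply; rewrite ge_max.
by case: (ger0P (x - y)) => _; apply/andP; split; lra.
Qed.

(** The left side is the variance of the information carried by a single binary coordinate. *)
Lemma log_odds_variance_le (x : R) : 0 <= x <= 1 ->
  x * (1 - x) * (ln (1 - x) - ln x) ^+ 2 <= 16.
Proof.
move=> x01; have x01' : 0 <= 1 - x <= 1 by lra.
have := mulr_ln_sqr_le x01; have := mulr_ln_sqr_le x01'.
set a := ln x; set b := ln (1 - x) => hb ha.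
move: x01 => /andP[x0 x1].
have h : (b - a) ^+ 2 <= 2 * b ^+ 2 + 2 * a ^+ 2.
  by have := sqr_ge0 (b + a); nra.
have xx : 0 <= x * (1 - x) by nra.
apply: (le_trans (ler_wpM2l xx h)).
have h1 : x * ((1 - x) * b ^+ 2) <= 1 * 4.
  by apply: ler_pM => //; apply: mulr_ge0; [lra|exact: sqr_ge0].
have h2 : (1 - x) * (x * a ^+ 2) <= 1 * 4.
  by apply: ler_pM => //; [lra|apply: mulr_ge0; [lra|exact: sqr_ge0]|lra].
have -> : x * (1 - x) * (2 * b ^+ 2 + 2 * a ^+ 2) =
  2 * (x * ((1 - x) * b ^+ 2)) + 2 * ((1 - x) * (x * a ^+ 2)) by ring.
lra.
Qed.

(* Convexity of the square, with weights [1 - |s|] and [|s|]. *)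
Lemma sqr_contraction (C d s D : R) : 0 <= C -> `|s| <= 1 -> d ^+ 2 <= C * (1 - `|s|) ->
  (d + s * D) ^+ 2 <= C + `|s| * D ^+ 2.
Proof.
move=> C0 s1 hd; set t := 1 - `|s|; have ts : `|s| = 1 - t by rewrite /t; ring.
have t0 : 0 <= t by rewrite subr_ge0.
have s2 : s ^+ 2 = (1 - t) ^+ 2 by rewrite -ts real_normK // num_real.
rewrite ts in s1 *; move: hd; rewrite -/t => hd.
(* For [t = 0] the hypothesis forces [d = 0], and the division by [t] below is avoided. *)
move: t0; rewrite le_eqVlt => /orP[/eqP t0|t0].
  have d0 : d = 0.
    apply/eqP; rewrite -sqrf_eq0 eq_le sqr_ge0 andbT.
    by rewrite -t0 mulr0 in hd.
  by rewrite d0 add0r exprMn s2 -t0 !subr0 expr1n !mul1r lerDr.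
pose u := d ^+ 2 / t; have uC : u <= C by rewrite ler_pdivrMr.
have ut : u * t = d ^+ 2 by rewrite divfK // gt_eqF.
(* Cross term by the arithmetic-geometric inequality [2 |d| |D| <= d ^+ 2 / t + t * D ^+ 2],
   multiplied by [|s| = 1 - t]. *)
have key : 2 * d * s * D <= (1 - t) * (u + t * D ^+ 2).
  have h : 2 * `|d| * `|D| <= u + t * D ^+ 2.
    rewrite -(ler_pM2l t0) -subr_ge0.
    have -> : t * (u + t * D ^+ 2) - t * (2 * `|d| * `|D|) = (`|d| - t * `|D|) ^+ 2.
      rewrite mulrDr (mulrC t u) ut -(real_normK (num_real d)) -(real_normK (num_real D)).
      by ring.
    exact: sqr_ge0.
  apply: (le_trans (ler_norm _)); rewrite !normrM ts ger0_norm //.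
  have -> : 2 * `|d| * (1 - t) * `|D| = (1 - t) * (2 * `|d| * `|D|) by ring.
  by rewrite ler_wpM2l // -ts.
have -> : (d + s * D) ^+ 2 = d ^+ 2 + 2 * d * s * D + s ^+ 2 * D ^+ 2 by ring.
rewrite s2 -ut; nra.
Qed.
End BinaryEntropy.

Section MarkovWords.
Variables (R : realType) (p q : nat -> R).
Hypothesis hp : forall n, 0 <= p n <= 1.
Hypothesis hq : forall n, 0 <= q n <= 1.

(* [step k e b] is the probability that the coordinate of index [k] is [b] when the
   previous one is [e]; the initial law is that of a chain preceded by [false]. *)
Definition param (k : nat) (e : bool) : R := if e then q k else p k.
Definition step (k : nat) (e b : bool) : R := if b then 1 - param k e else param k e.

(** The starting index and the preceding state are arguments, so that conditioning on the first
    coordinate is structural recursion. *)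
Fixpoint word_prob (k : nat) (e : bool) (w : seq bool) : R :=
  if w is b :: w' then step k e b * word_prob k.+1 b w' else 1.

Lemma word_prob_prod k e w :
  word_prob k e w = \prod_(i < size w) step (k + i) (nth false (e :: w) i) (nth false w i).
Proof.
elim: w k e => [|b w IH] k e /=; first by rewrite big_ord0.
rewrite big_ord_recl /= addn0 IH; congr (_ * _).
by apply: eq_bigr => i _; rewrite /= addSnnS.
Qed.

Lemma markov_cylE w : markov_cyl p q w = word_prob 0 false w.
Proof.
rewrite word_prob_prod; apply: eq_bigr => -[i wi] _ /=.
by rewrite /markov_factor /step /param add0n; case: i wi.
Qed.

Lemma param01 k e : 0 <= param k e <= 1.
Proof. by rewrite /param; case: e. Qed.

Lemma step01 k e b : 0 <= step k e b <= 1.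
Proof. by rewrite /step; have := param01 k e; case: b => //; lra. Qed.

Lemma word_prob01 k e w : 0 <= word_prob k e w <= 1.
Proof.
elim: w k e => [|b w IH] k e /=; first by rewrite ler01 /=.
have /andP[s0 s1] := step01 k e b; have /andP[w0 w1] := IH k.+1 b.
by rewrite mulr_ge0 //= mulr_ile1 //.
Qed.

Lemma word_prob_rcons_le k e w b : word_prob k e (rcons w b) <= word_prob k e w.
Proof.
elim: w k e => [|c w IH] k e /=; first by rewrite mulr1; case/andP: (step01 k e b).
by apply: ler_wpM2l; [case/andP: (step01 k e c)|exact: IH].
Qed.

Lemma sum_tuple_cons m (F : seq bool -> R) :
  \sum_(w : m.+1.-tuple bool) F w = \sum_(w : m.-tuple bool) F (false :: w)
                                  + \sum_(w : m.-tuple bool) F (true :: w).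
Proof.
pose h (bw : bool * m.-tuple bool) : m.+1.-tuple bool := [tuple of bw.1 :: bw.2].
rewrite (reindex h) /=; last first.
  exists (fun w => (thead w, [tuple of behead w])) => [[b w] _|w _].
    by congr pair; apply/val_inj.
  by rewrite [RHS]tuple_eta; apply/val_inj.
rewrite -(pair_bigA _ (fun b w => F (b :: val w))) /= big_bool addrC.
by [].
Qed.

(* [word_entropy m k e]: entropy of the coordinates [k, ..., k + m - 1] given that the
   coordinate of index [k - 1] is [e]; [word_variance m k e]: conditional variance of their
   information content. *)
Definition word_entropy m k e : R :=
  \sum_(w : m.-tuple bool) - xlogx (word_prob k e w).

Definition word_variance m k e : R :=
  \sum_(w : m.-tuple bool)
    word_prob k e w * (- ln (word_prob k e w) - word_entropy m k e) ^+ 2.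

Lemma xlogxE (x : R) : xlogx x = x * ln x.
Proof. by rewrite /xlogx; case: eqP => // ->; rewrite mul0r. Qed.

Lemma sum_word_prob m k e : \sum_(w : m.-tuple bool) word_prob k e w = 1.
Proof.
elim: m k e => [|m IH] k e.
  rewrite (eq_bigr (fun=> 1)); last by move=> w _; rewrite tuple0.
  by rewrite sumr_const card_tuple expn0.
rewrite (sum_tuple_cons _ (word_prob k e)) /= -!mulr_sumr !IH !mulr1 /step; ring.
Qed.

Lemma entropy0 k e : word_entropy 0 k e = 0.
Proof. by rewrite /word_entropy big1 // => w _; rewrite tuple0 /= xlogxE ln1 mulr0 oppr0. Qed.

(** The logarithm of the product splits only when both factors are nonzero; otherwise the weight in
    front kills both sides. *)
Lemma mul_ln_word_prob_cons k e b w : word_prob k e (b :: w) * ln (word_prob k e (b :: w)) =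
  step k e b * (word_prob k.+1 b w * (ln (step k e b) + ln (word_prob k.+1 b w))).
Proof.
rewrite /=; have [->|s0] := eqVneq (step k e b) 0; first by rewrite !mul0r.
have [->|w0] := eqVneq (word_prob k.+1 b w) 0; first by rewrite !(mul0r, mulr0).
rewrite lnM ?mulrA // posrE lt_neqAle eq_sym ?s0 ?w0.
  by case/andP: (step01 k e b).
by case/andP: (word_prob01 k.+1 b w).
Qed.

Lemma entropyS m k e : word_entropy m.+1 k e =
  binary_entropy (param k e) + (param k e * word_entropy m k.+1 false
                                + (1 - param k e) * word_entropy m k.+1 true).
Proof.
have H b : \sum_(w : m.-tuple bool) - xlogx (word_prob k e (b :: w)) =
    step k e b * (- ln (step k e b) + word_entropy m k.+1 b).
  under eq_bigr do rewrite xlogxE mul_ln_word_prob_cons -mulrN mulrDr opprD.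
  rewrite -mulr_sumr big_split /=; congr (_ * (_ + _)).
    by under eq_bigr do rewrite -mulrN; rewrite -mulr_suml sum_word_prob mul1r.
  by under eq_bigr do rewrite -xlogxE.
rewrite {1}/word_entropy (sum_tuple_cons _ (fun w => - xlogx (word_prob k e w))) !H.
by rewrite /step /binary_entropy; ring.
Qed.

(** By induction the increment is an average of conditional increments, down to a single binary
    entropy. It controls the mean information between consecutive squares. *)
Lemma entropyS_bounds m k e : 0 <= word_entropy m.+1 k e - word_entropy m k e <= 4.
Proof.
elim: m k e => [|m IH] k e.
  rewrite entropyS !entropy0 !mulr0 !addr0 subr0.
  by rewrite binary_entropy_ge0 ?binary_entropy_le //; exact: param01.
rewrite (entropyS m.+1) (entropyS m k e).
have := IH k.+1 false; have := IH k.+1 true; have /andP[] := param01 k e.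
set r := param k e; set h := binary_entropy _.
set a := word_entropy m.+1 k.+1 true; set b := word_entropy m k.+1 true.
set c := word_entropy m.+1 k.+1 false; set d := word_entropy m k.+1 false.
move=> r0 r1 /andP[d1 d2] /andP[d3 d4].
have -> : h + (r * c + (1 - r) * a) - (h + (r * d + (1 - r) * b)) =
  r * (c - d) + (1 - r) * (a - b) by ring.
by apply/andP; split; nra.
Qed.

Lemma two_point_variance (r x y : R) :
  r * (x - (r * x + (1 - r) * y)) ^+ 2 + (1 - r) * (y - (r * x + (1 - r) * y)) ^+ 2
  = r * (1 - r) * (x - y) ^+ 2.
Proof. ring. Qed.

(** Law of total variance, conditioning on the coordinate of index [k]: the mean of the conditional
    variances plus the variance of the two conditional means. *)
Lemma word_varianceS m k e : word_variance m.+1 k e =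
  param k e * word_variance m k.+1 false + (1 - param k e) * word_variance m k.+1 true +
  param k e * (1 - param k e) * (ln (1 - param k e) - ln (param k e)
     + (word_entropy m k.+1 false - word_entropy m k.+1 true)) ^+ 2.
Proof.
set g := word_entropy m.+1 k e.
have H b : \sum_(w : m.-tuple bool) word_prob k e (b :: w) *
      (- ln (word_prob k e (b :: w)) - g) ^+ 2 =
    step k e b * (word_variance m k.+1 b + (- ln (step k e b) + word_entropy m k.+1 b - g) ^+ 2).
  set c := - ln (step k e b) + word_entropy m k.+1 b - g.
  (* The square is expanded about the conditional mean; [c] is the offset of that mean from [g], and
     the term in [2 * c] sums to zero. *)
  have E (w : seq bool) : word_prob k e (b :: w) * (- ln (word_prob k e (b :: w)) - g) ^+ 2 =
    step k e b * (word_prob k.+1 b w * (- ln (word_prob k.+1 b w) - word_entropy m k.+1 b) ^+ 2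
      + 2 * c * (- xlogx (word_prob k.+1 b w) - word_prob k.+1 b w * word_entropy m k.+1 b)
      + word_prob k.+1 b w * c ^+ 2).
    rewrite /= xlogxE; have [->|s0] := eqVneq (step k e b) 0; first by rewrite !mul0r.
    have [->|w0] := eqVneq (word_prob k.+1 b w) 0; first by rewrite !(mul0r, mulr0); ring.
    rewrite lnM; first by rewrite /c; ring.
      by rewrite posrE lt_neqAle eq_sym s0; case/andP: (step01 k e b).
    by rewrite posrE lt_neqAle eq_sym w0; case/andP: (word_prob01 k.+1 b w).
  under eq_bigr do rewrite E.
  rewrite -mulr_sumr !big_split /= -mulr_sumr -mulr_suml sum_word_prob sumrB.
  by rewrite -mulr_suml sum_word_prob; congr (_ * _); rewrite /word_variance /word_entropy; ring.
rewrite {1}/word_variance -/g.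
rewrite (sum_tuple_cons _ (fun w => word_prob k e w * (- ln (word_prob k e w) - g) ^+ 2)) !H.
rewrite /step; set r := param k e.
set a0 := - ln r + _; set a1 := - ln (1 - r) + _.
(* The overall mean is the average of the conditional means [a0] and [a1], so [two_point_variance]
   applies. *)
have -> : g = r * a0 + (1 - r) * a1.
  by rewrite /g entropyS /binary_entropy -/r /a0 /a1; ring.
transitivity (r * word_variance m k.+1 false + (1 - r) * word_variance m k.+1 true +
  r * (1 - r) * (a0 - a1) ^+ 2); first by rewrite -two_point_variance; ring.
by congr (_ + _ * _ ^+ 2); rewrite /a0 /a1; ring.
Qed.

(** According to the sign of [p k - q k], the right side is [(1 - p k) + q k] or [p k + (1 - q k)].
    Either way one summand is [param k e] or its complement, hence at least their product. *)
Lemma param_mixing k e : param k e * (1 - param k e) <= 1 - `|p k - q k|.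
Proof.
have := hp k; have := hq k; rewrite /param => /andP[q0 q1] /andP[p0 p1].
by case: e; case: (ger0P (p k - q k)) => _; nra.
Qed.

(* The entropy gap [D] between the two initial states satisfies
   [D_k ^ 2 <= 10 + |p_k - q_k| D_(k+1) ^ 2]; what is lost in this contraction pays for
   the term [(1 - |p_k - q_k|) D_(k+1) ^ 2] which enters the variance. *)
Lemma word_variance_le m k e :
  word_variance m k e + 2 * (word_entropy m k false - word_entropy m k true) ^+ 2 <= 52 * m%:R.
Proof.
elim: m k e => [|m IH] k e.
  rewrite !entropy0 subrr expr0n mulr0 mulr0 addr0 /word_variance big1 // => w _.
  by rewrite tuple0 /= ln1 entropy0 !oppr0 addr0 expr0n mulr0.
rewrite word_varianceS.
have gap : (word_entropy m.+1 k false - word_entropy m.+1 k true) ^+ 2 <=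
    10 + `|p k - q k| * (word_entropy m k.+1 false - word_entropy m k.+1 true) ^+ 2.
  rewrite !entropyS /=; set a := word_entropy m _ false; set b := word_entropy m _ true.
  have -> : binary_entropy (p k) + (p k * a + (1 - p k) * b) -
      (binary_entropy (q k) + (q k * a + (1 - q k) * b)) =
    binary_entropy (p k) - binary_entropy (q k) + (p k - q k) * (a - b) by ring.
  apply: sqr_contraction => //; last exact: binary_entropy_gap.
  have := hp k; have := hq k => /andP[q0 q1] /andP[p0 p1].
  by rewrite ler_norml; lra.
have mix := param_mixing k e; have odds := log_odds_variance_le (param01 k e).
have := IH k.+1 false; have := IH k.+1 true; have /andP[r0 r1] := param01 k e.
move: gap odds mix; set D := word_entropy m _ _ - _; set D' := word_entropy m.+1 _ _ - _.
set r := param k e in r0 r1 *; set l := ln _ - ln _; set t := `|_|.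
set V1 := word_variance _ _ true; set V0 := word_variance _ _ false => gap odds mix h1 h0.
(* From [(l + D) ^+ 2 <= 2 * l ^+ 2 + 2 * D ^+ 2]: the log-odds bound 16 is doubled, and [mix]
   handles the other term. *)
have v : r * (1 - r) * (l + D) ^+ 2 <= 32 + 2 * (1 - t) * D ^+ 2.
  have : r * (1 - r) * (l + D) ^+ 2 <= r * (1 - r) * (2 * l ^+ 2 + 2 * D ^+ 2).
    apply: ler_wpM2l; first by nra.
    by have := sqr_ge0 (l - D); nra.
  have := ler_wpM2r (sqr_ge0 D) mix.
  by lra.
have : r * V0 + (1 - r) * V1 <= 52 * m%:R - 2 * D ^+ 2.
  have : r * V0 <= r * (52 * m%:R - 2 * D ^+ 2) by apply: ler_wpM2l => //; lra.
  have : (1 - r) * V1 <= (1 - r) * (52 * m%:R - 2 * D ^+ 2) by apply: ler_wpM2l; lra.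
  by lra.
(* The coefficients of [D ^+ 2] cancel, [- 2 + 2 * (1 - t) + 2 * t = 0], and the constants add up to
   [32 + 2 * 10 = 52]. *)
by rewrite -natr1; lra.
Qed.
End MarkovWords.

(** * Metric and cylinders *)

Section CantorMetric.
Variable R : realType.
Implicit Types (x y : Kt) (n : nat).

Definition icyl n x : set Kt := cyl (mkseq x n).

Lemma take_mkseq (T : Type) (f : nat -> T) m n : (m <= n)%N ->
  take m (mkseq f n) = mkseq f m.
Proof. by move=> mn; rewrite /mkseq -map_take take_iota (minn_idPl mn). Qed.

Lemma icylP n x y : icyl n x y <-> (forall i, (i < n)%N -> y i = x i).
Proof.
rewrite /icyl /cyl /= size_mkseq.
by split=> h i ni; have := h i ni; rewrite nth_mkseq.
Qed.

Lemma icyl_refl n x : icyl n x x.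
Proof. exact/icylP. Qed.

Lemma cylE w x : cyl w x <-> mkseq x (size w) = w.
Proof.
split=> [h|<- i]; last by rewrite size_mkseq => ?; rewrite nth_mkseq.
apply: (@eq_from_nth _ false); rewrite ?size_mkseq // => i ni.
by rewrite nth_mkseq // h.
Qed.

Lemma halfX_gt0 n : 0 < (2^-1 : R) ^+ n.
Proof. by rewrite exprn_gt0 // invr_gt0. Qed.

Lemma halfX_le m n : ((2^-1 : R) ^+ m <= 2^-1 ^+ n) = (n <= m)%N.
Proof. by rewrite ler_iXn2l ?invr_gt0 // invf_lt1 // ltr1n. Qed.

Lemma dK_ge x y k : x k != y k -> (2^-1) ^+ k <= dK R x y.
Proof.
move=> xy; apply: ub_le_sup; last by exists k.
by exists 1 => _ [j _ <-]; have := halfX_le j 0; rewrite expr0.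
Qed.

Lemma dK_leP x y n : dK R x y <= (2^-1) ^+ n <-> icyl n x y.
Proof.
split=> [h|/icylP h].
  apply/icylP => i ni; apply/eqP/negPn/negP => xy.
  have := @dK_ge x y i; rewrite eq_sym => /(_ xy)/le_trans/(_ h).
  by rewrite halfX_le leqNgt ni.
rewrite /dK; set S := (X in sup X).
(* No coordinate differs when the points are equal; the supremum of the empty set is then 0. *)
have [->|/set0P S0] := eqVneq S set0; first by rewrite sup0 ltW // halfX_gt0.
apply: ge_sup => // _ [k /= xy <-]; rewrite halfX_le leqNgt; apply/negP => kn.
by rewrite h // eqxx in xy.
Qed.

Lemma diamK_ge (U : set Kt) x y : U x -> U y -> dK R x y <= diamK R U.
Proof.
move=> Ux Uy; apply: ub_le_sup; last by exists x, y.
exists 1 => _ [a [b [_ [_ ->]]]]; have := @dK_leP a b 0; rewrite expr0 => ->.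
exact/icylP.
Qed.

Lemma diamK_le (U : set Kt) n :
  (forall x y, U x -> U y -> icyl n x y) -> diamK R U <= 2^-1 ^+ n.
Proof.
move=> h; rewrite /diamK; set S := (X in sup X).
have [->|/set0P S0] := eqVneq S set0; first by rewrite sup0 ltW // halfX_gt0.
by apply: ge_sup => // _ [x [y [Ux [Uy ->]]]]; apply/dK_leP/h.
Qed.

Lemma diamK_ge0 (U : set Kt) x : U x -> 0 <= diamK R U.
Proof.
move=> Ux; apply: le_trans (diamK_ge Ux Ux).
rewrite /dK; suff -> : [set k | x k != x k] = set0 by rewrite image_set0 sup0.
by apply/seteqP; split=> // k /=; rewrite eqxx.
Qed.

Lemma diamK_cyl w : diamK R (cyl w) <= 2^-1 ^+ size w.
Proof.
apply: diamK_le => x y wx wy; apply/icylP => i iw.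
by rewrite wx // wy.
Qed.

Lemma icyl_ballK n x (r : R) : (2^-1) ^+ n <= r -> icyl n x `<=` ballK x r.
Proof. by move=> nr y /dK_leP/le_trans; apply. Qed.

Lemma ballK_half n x : ballK x ((2^-1) ^+ n : R) = icyl n x.
Proof. by apply/seteqP; split=> y /dK_leP. Qed.

Lemma diamK_icyl (U : set Kt) x N : U x -> diamK R U <= 2^-1 ^+ N ->
  (forall n, U `<=` icyl n x) \/
  exists n, [/\ (N <= n)%N, U `<=` icyl n x & 2^-1 ^+ n <= diamK R U].
Proof.
move=> Ux dU; have [|] := pselect (forall n, U `<=` icyl n x); first by left.
move=> /existsNP h; right.
have {}h : exists n, `[< ~ U `<=` icyl n x >] by case: h => n hn; exists n; apply/asboolP.
case: (ex_minnP h) => -[|n] /asboolP hn hmin.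
  by exfalso; apply: hn => y _; apply/icylP.
have Un : U `<=` icyl n x.
  by apply: contrapT => /asboolP/hmin; rewrite ltnn.
exists n; split => //.
  rewrite leqNgt; apply/negP => nN; apply: hn => y Uy.
  apply/dK_leP; apply: (le_trans (diamK_ge Ux Uy)); apply: (le_trans dU).
  by rewrite halfX_le.
have /existsNP[y /not_implyP[Uy nxy]] := hn.
apply: le_trans (diamK_ge Ux Uy).
have [xy|/negPn/eqP xy] := boolP (x n != y n); first exact: dK_ge.
exfalso; apply: nxy; apply/icylP => i; rewrite ltnS leq_eqVlt => /orP[/eqP->//|].
by move: i; apply/icylP/Un.
Qed.

Lemma halfX_powR n (s : R) : (2^-1 ^+ n : R) `^ s = expR (- (n%:R * s * ln 2)).
Proof.
rewrite /powR gt_eqF ?halfX_gt0 // lnXn ?invr_gt0 // lnV ?posrE //.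
by rewrite -mulr_natl; congr expR; ring.
Qed.

Lemma halfX_small (e : R) : 0 < e -> exists n, (2^-1) ^+ n <= e.
Proof.
move=> e0; have : (fun n => (2^-1 : R) ^+ n) @ \oo --> (0 : R).
  by apply: cvg_expr; rewrite ger0_norm ?invr_ge0 // invf_lt1 // ltr1n.
move=> /cvgr0Pnorm_le/(_ _ e0)[n _ /(_ n (leqnn n))] /=.
by rewrite gtr0_norm ?halfX_gt0 // => h; exists n.
Qed.

End CantorMetric.

(** * Extended real limits and comparison tools *)

Section LimsupEreal.
Variable R : realType.
Implicit Types (u : (\bar R)^nat) (t : \bar R).

Lemma limn_esup_lt u t : (limn_esup u < t)%E ->
  exists N, forall n, (N <= n)%N -> (u n < t)%E.
Proof.
move=> /ereal_inf_lt[_ [V [N _ NV] <-]] Vt; exists N => n Nn.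
by apply: le_lt_trans Vt; apply: ereal_sup_ubound; exists n => //; exact: NV.
Qed.

Lemma limn_esup_gt u t : (t < limn_esup u)%E ->
  forall N, exists2 n, (N <= n)%N & (t < u n)%E.
Proof.
move=> tu N.
have : (t < ereal_sup [set u n | n in [set n | (N <= n)%N]])%E.
  apply: (lt_le_trans tu); apply: ereal_inf_lbound.
  by exists [set n | (N <= n)%N] => //; exists N.
by move=> /ereal_sup_gt[_ [n Nn <-] tn]; exists n.
Qed.

Lemma limn_einf_gt u t : (t < limn_einf u)%E ->
  exists N, forall n, (N <= n)%N -> (t < u n)%E.
Proof.
rewrite /limn_einf lteNr => /limn_esup_lt[N h]; exists N => n /h.
by rewrite lteN2.
Qed.

Lemma limn_einf_lt u t : (limn_einf u < t)%E ->
  forall N, exists2 n, (N <= n)%N & (u n < t)%E.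
Proof.
rewrite /limn_einf lteNl => tu N; have [n Nn h] := limn_esup_gt tu N.
by exists n => //; rewrite lteN2 in h.
Qed.

Lemma lt_between (h d : \bar R) : (h < d)%E -> exists s : R, (h < s%:E < d)%E.
Proof.
case: h d => [h||] [d||] // hd.
- by exists ((h + d) / 2); rewrite !lte_fin; rewrite lte_fin in hd; lra.
- by exists (h + 1); rewrite lte_fin ltry andbT; lra.
- by exists (d - 1); rewrite ltNyr lte_fin /=; lra.
- by exists 0; rewrite ltNyr ltry.
Qed.

Lemma le_of_lt_EFin (d h : \bar R) : (forall s : R, (h < s%:E)%E -> (d <= s%:E)%E) ->
  (d <= h)%E.
Proof.
move=> H; rewrite leNgt; apply/negP => /lt_between[s /andP[hs sd]].
by have := le_lt_trans (H _ hs) sd; rewrite ltxx.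
Qed.

Lemma nneseries_le_partial (u : (\bar R)^nat) c :
  (forall n, 0 <= u n)%E -> (forall n, \sum_(0 <= i < n) u i <= c)%E ->
  (\sum_(i <oo) u i <= c)%E.
Proof.
move=> u0 h; apply: lime_le; first by apply: is_cvg_nneseries => n _ _.
by near=> n; exact: h.
Unshelve. all: by end_near. Qed.

Lemma ge0_le_geometric (x : \bar R) (C c : R) : (0 <= x)%E -> 0 < c < 1 ->
  (forall n, x <= (C * c ^+ n)%:E)%E -> x = 0%E.
Proof.
move=> x0 /andP[c0 c1] h; apply/eqP; rewrite eq_le x0 andbT.
have : (fun n => (C * c ^+ n)%:E) @ \oo --> (C * 0)%:E.
  apply: cvg_EFin; first by near=> n.
  apply: cvgMr; apply: cvg_expr; rewrite gtr0_norm //.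
rewrite mulr0 => cv.
suff : (x <= limn (fun n => (C * c ^+ n)%:E))%E by rewrite (cvg_lim _ cv).
apply: lime_ge; first by apply/cvg_ex; exists 0%E.
by near=> n.
Unshelve. all: by end_near. Qed.
End LimsupEreal.

(** * Measurability of events on prefixes *)

Section CylinderMeasure.
Lemma measurable_cyl w : measurable (cyl w : set KM).
Proof. by apply: sub_gen_smallest; exists w. Qed.

Lemma measurable_icyl n x : measurable (icyl n x : set KM).
Proof. exact: measurable_cyl. Qed.

Lemma measurable_prefix n (P : set (seq bool)) :
  measurable ([set x | P (mkseq x n)] : set KM).
Proof.
have -> : [set x : KM | P (mkseq x n)] =
    \bigcup_(w in [set: seq bool]) (if `[< size w = n /\ P w >] then cyl w else set0).
  apply/seteqP; split=> [x Px|x [w _]].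
    exists (mkseq x n) => //; case: asboolP => [_|[]]; last by rewrite size_mkseq.
    exact: icyl_refl.
  by case: asboolP => // -[sw Pw] /cylE; rewrite sw /= => ->.
apply: countable_bigcupT_measurable; first exact: countableP.
by move=> w; case: asboolP => _ //; exact: measurable_cyl.
Qed.

End CylinderMeasure.

(** * Hausdorff measures and local dimension *)

Section StoppingWords.
Implicit Type Good : set (seq bool).

Definition first_word Good (w : seq bool) :=
  Good w /\ forall j, (j < size w)%N -> ~ Good (take j w).

(** The first words are enumerated by their codes, so that covers and countable additivity apply to
    a sequence; all other indices give the empty set. *)
Definition stop_cyl Good (i : nat) : set KM :=
  if pickle_inv i is Some w then
    if `[< first_word Good w >] then cyl w else set0
  else set0.

Lemma stop_cylP Good i : stop_cyl Good i = set0 \/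
  exists w, [/\ first_word Good w, i = pickle w & stop_cyl Good i = cyl w].
Proof.
rewrite /stop_cyl; case E : (pickle_inv i) => [w|]; last by left.
case: asboolP => [fw|_]; [right|by left]; exists w; split=> //.
by have := @pickle_invK (seq bool) i; rewrite E /= => <-.
Qed.

Lemma measurable_stop_cyl Good i : measurable (stop_cyl Good i).
Proof.
by have [->//|[w [_ _ ->]]] := stop_cylP Good i; exact: measurable_cyl.
Qed.

(** Both words are prefixes of [x]; were their lengths different, the shorter would be a good proper
    prefix of the longer. *)
Lemma first_word_inj Good w v x : first_word Good w -> first_word Good v ->
  cyl w x -> cyl v x -> w = v.
Proof.
have H a b : first_word Good a -> first_word Good b -> cyl a x -> cyl b x ->
    (size a < size b)%N -> False.
  move=> [ga _] [_ mb] /cylE ea /cylE eb ab; apply: (mb _ ab).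
  suff -> : take (size a) b = a by [].
  by rewrite -eb -[in RHS]ea take_mkseq // ltnW.
move=> fw fv wx vx; case: (ltngtP (size w) (size v)) => [/(H _ _ fw fv wx vx)//|
  /(H _ _ fv fw vx wx)//|e].
by move: wx vx => /cylE <- /cylE <-; rewrite e.
Qed.

Lemma trivIset_stop_cyl Good : trivIset setT (stop_cyl Good).
Proof.
move=> i j _ _ [x []].
have [->//|[w [fw -> ->]]] := stop_cylP Good i.
have [->//|[v [fv -> ->]]] := stop_cylP Good j.
by move=> wx vx; rewrite (first_word_inj fw fv wx vx).
Qed.

Lemma stop_cyl_cover Good n x : Good (mkseq x n) -> exists i, stop_cyl Good i x.
Proof.
move=> gx; have h : exists n, `[< Good (mkseq x n) >] by exists n; apply/asboolP.
case: (ex_minnP h) => k /asboolP gk kmin; exists (pickle (mkseq x k)).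
rewrite /stop_cyl pickleK_inv; case: asboolP => [_|[]]; first exact: icyl_refl.
split=> // j; rewrite size_mkseq => jk; rewrite take_mkseq ?(ltnW jk) // => gj.
by have := kmin j; rewrite leqNgt jk => /(_ _)/negP; apply => //; apply/asboolP.
Qed.

End StoppingWords.

Section LocalDimension.
Variables (R : realType) (mu : {measure set KM -> \bar R}).
Hypothesis hmu1 : mu setT = 1%E.

Lemma powR_half_lt1 (s : R) : 0 < s -> 0 < (2^-1 : R) `^ s < 1.
Proof.
move=> s0; rewrite powR_gt0 ?invr_gt0 //= /powR gt_eqF ?invr_gt0 //.
by rewrite -[ltRHS]expR0 ltr_expR pmulr_rlt0 // ln_lt0 //; lra.
Qed.

Lemma half_powRX n (s : R) : (2^-1 ^+ n) `^ s = ((2^-1 : R) `^ s) ^+ n.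
Proof. by rewrite -!powR_mulrn ?powR_ge0 ?invr_ge0 // -!powRrM mulrC. Qed.

Lemma diam_pow_ge0 s U : (0 <= diam_pow (R := R) s U)%E.
Proof. by rewrite /diam_pow; case: ifP => // _; rewrite lee_fin powR_ge0. Qed.

Lemma hausdorff_delta_ge0 s delta E : (0 <= hausdorff_delta (R := R) s delta E)%E.
Proof.
apply/ereal_infP => _ [U _ <-]; apply: nneseries_ge0 => i _ _; exact: diam_pow_ge0.
Qed.

(* The first cylinders around the points of [E] where [2^-nt <= mu] are disjoint, and
   there [diam^s <= 2^-N(s-t) mu]. *)
Lemma hausdorff_eq0 (E : set Kt) (s t : R) : 0 <= t < s ->
  (forall x, E x -> forall N, exists2 n, (N <= n)%N &
     (((2^-1 ^+ n) `^ t)%:E <= mu (icyl n x))%E) ->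
  hausdorff s E = 0%E.
Proof.
move=> /andP[t0 ts] hE.
have st : 0 < s - t by rewrite subr_gt0.
apply/eqP; rewrite eq_le; apply/andP; split; last first.
  apply: (le_trans (hausdorff_delta_ge0 s 1 E)); apply: ereal_sup_ubound.
  by exists 1 => //=.
apply/ereal_supP => _ [delta /= delta0 <-].
suff -> : hausdorff_delta s delta E = 0%E by [].
have [N0 HN0] : exists n, 2^-1 ^+ n <= delta by exact: halfX_small.
apply: (@ge0_le_geometric _ _ 1 ((2^-1) `^ (s - t))); first exact: hausdorff_delta_ge0.
  exact: powR_half_lt1.
move=> N; rewrite mul1r.
(* Length at least [N0] keeps the diameters below [delta]; the additional [N] produces the factor
   that tends to 0. *)
pose Good := [set w | (N0 + N <= size w)%N /\
  (((2^-1 ^+ size w) `^ t)%:E <= mu (cyl w))%E].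
have H i : (diam_pow s (stop_cyl Good i) <=
   (((2^-1 `^ (s - t)) ^+ N)%:E * mu (stop_cyl Good i)))%E.
  have [->|[w [[[Nw gw] _] _ ->]]] := stop_cylP Good i.
    by rewrite measure0 mule0 /diam_pow; case: asboolP => // -[x []].
  apply: (@le_trans _ _ (((2^-1 ^+ size w) `^ s)%:E)).
    rewrite /diam_pow; case: asboolP => [[x wx]|_]; rewrite lee_fin ?powR_ge0 //.
    apply: ge0_ler_powR; first exact: ltW (le_lt_trans t0 ts).
    - by rewrite nnegrE (diamK_ge0 _ wx).
    - by rewrite nnegrE ltW // halfX_gt0.
    - exact: diamK_cyl.
  have -> : (2^-1 ^+ size w) `^ s =
      (2^-1 ^+ size w : R) `^ (s - t) * (2^-1 ^+ size w) `^ t.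
    by rewrite -powRD ?subrK // (gt_eqF (halfX_gt0 _ _)) implybT.
  rewrite EFinM; apply: lee_pmul; rewrite ?lee_fin ?powR_ge0 //.
  rewrite half_powRX; have /andP[c0 c1] := powR_half_lt1 st.
  by rewrite ler_iXn2l // (leq_trans (leq_addl _ _) Nw).
apply: ereal_inf_le; exists (\sum_(i <oo) diam_pow s (stop_cyl Good i))%E.
  exists (stop_cyl Good) => //; split=> [x Ex|i].
    have [n Nn hn] := hE x Ex (N0 + N)%N.
    have [|i ix] := @stop_cyl_cover Good n x; last by exists i.
    by split; rewrite size_mkseq.
  have [->|[w [[[Nw gw] _] _ ->]]] := stop_cylP Good i.
    by apply: le_trans HN0; apply: diamK_le.
  apply: (le_trans (diamK_cyl _ _)); apply: le_trans HN0; rewrite halfX_le.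
  exact: leq_trans (leq_addr _ _) Nw.
apply: (@le_trans _ _ (\sum_(i <oo) (((2^-1 `^ (s - t)) ^+ N)%:E * mu (stop_cyl Good i)))%E).
  by apply: lee_nneseries => [i _ _|i _]; [exact: diam_pow_ge0|exact: H].
rewrite nneseriesZl; last by move=> i _; exact: measure_ge0.
rewrite -[leRHS]mule1; apply: lee_wpmul2l.
  by rewrite lee_fin exprn_ge0 // powR_ge0.
rewrite -(measure_semi_bigcup _ (measurable_stop_cyl Good) (@trivIset_stop_cyl Good)).
  by rewrite -hmu1; apply: le_measure; rewrite ?inE //; apply: bigcup_measurable => i _;
    exact: measurable_stop_cyl.
by apply: bigcup_measurable => i _; exact: measurable_stop_cyl.
Qed.

Lemma measure_bigcup_gt0 (A : nat -> set KM) : (forall i, measurable (A i)) ->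
  (0 < mu (\bigcup_i A i))%E -> exists i, (0 < mu (A i))%E.
Proof.
move=> mA h; apply: contrapT => /forallNP hn.
have A0 i : mu (A i) = 0%E.
  by apply/eqP; rewrite eq_le measure_ge0 andbT leNgt; apply/negP.
have := @measure_sigma_subadditive _ _ _ mu _ A mA (bigcup_measurable (fun k _ => mA k))
  (@subset_refl _ _).
rewrite eseries0 => [|i _ _]; last exact: A0.
by rewrite leNgt h.
Qed.

(** Mass distribution principle. The bound holds from a common generation [N] on a part [B N] of
    positive measure, and every cover of [E] at scale [2^-N] then has sum at least [mu (B N)]. *)
Lemma hausdorff_gt0 (A E : set KM) (s : R) : 0 <= s -> measurable A -> A `<=` E ->
  (0 < mu A)%E ->
  (forall x, A x -> exists N, forall n, (N <= n)%N ->
     (mu (icyl n x) <= ((2^-1 ^+ n) `^ s)%:E)%E) ->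
  (0 < hausdorff s E)%E.
Proof.
move=> s0 mA AE muA hA.
pose B N : set KM := A `&` \bigcap_(n in [set n | (N <= n)%N])
  [set x | [set w | (mu (cyl w) <= ((2^-1 ^+ n) `^ s)%:E)%E] (mkseq x n)].
have mB N : measurable (B N).
  apply: measurableI => //; apply: bigcap_measurableType => n _; exact: measurable_prefix.
have AB : A = \bigcup_N B N.
  apply/seteqP; split=> [x Ax|x [N _ []]//].
  by have [N hN] := hA x Ax; exists N => //; split.
rewrite AB in muA; have [N BN] := measure_bigcup_gt0 mB muA.
apply: (lt_le_trans BN).
apply: (@le_trans _ _ (hausdorff_delta s (2^-1 ^+ N) E)); last first.
  by apply: ereal_sup_ubound; exists (2^-1 ^+ N) => //=; exact: halfX_gt0.
apply/ereal_infP => _ [U [EU dU] <-].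
(* The covering sets may fail to be measurable, so each is replaced, on [B N], by a measurable set
   of no larger cost. *)
have HV i : exists V : set KM, [/\ measurable V, B N `&` U i `<=` V &
    (mu V <= diam_pow s (U i))%E].
  have [[x [[Ax Bx] Ux]]|/set0P/negP/negPn/eqP->] := pselect (B N `&` U i !=set0); last first.
    by exists set0; split => //; rewrite measure0 diam_pow_ge0.
  have dp : diam_pow s (U i) = ((diamK R (U i)) `^ s)%:E.
    by rewrite /diam_pow; case: asboolP => // -[]; exists x.
  have [Usub|[n [Nn Un dn]]] := diamK_icyl Ux (dU i).
    exists (\bigcap_n icyl n x); split.
      by apply: bigcapT_measurable => n; exact: measurable_icyl.
      by move=> y [_ Uy] n _; exact: Usub Uy.
    have mle n : (mu (\bigcap_n icyl n x) <= mu (icyl n x))%E.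
      apply: le_measure; rewrite ?inE; [apply: bigcapT_measurable => k| |];
        try exact: measurable_icyl.
      by move=> y; apply.
    (* Here [U i] is a single point. For [s = 0] it may be an atom, but its cost is [0 ^ 0 = 1]; for
       [s > 0] the bounds on all cylinders make it null. *)
    have [s00|sn0] := eqVneq s 0.
      rewrite dp s00 powRr0 -hmu1; apply: le_measure; rewrite ?inE //.
      by apply: bigcapT_measurable => n; exact: measurable_icyl.
    have sp : 0 < s by rewrite lt_neqAle eq_sym sn0.
    suff -> : mu (\bigcap_n icyl n x) = 0%E by exact: diam_pow_ge0.
    apply: (@ge0_le_geometric _ _ 1 (2^-1 `^ s)); first exact: measure_ge0.
      exact: powR_half_lt1.
    move=> n; apply: (le_trans (mle (N + n)%N)); rewrite mul1r.
    apply: (le_trans (Bx (N + n)%N _)); first exact: leq_addr.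
    rewrite half_powRX lee_fin; have /andP[c0 c1] := powR_half_lt1 sp.
    by rewrite ler_iXn2l // leq_addl.
  exists (icyl n x); split; [exact: measurable_icyl|by move=> y [_ /Un]|].
  apply: (le_trans (Bx n Nn)); rewrite dp lee_fin.
  apply: ge0_ler_powR => //; first by rewrite nnegrE ltW // halfX_gt0.
  by rewrite nnegrE (diamK_ge0 _ Ux).
have /choice[V HVV] := HV.
apply: (@le_trans _ _ (\sum_(i <oo) mu (V i))%E).
  apply: measure_sigma_subadditive => // [i|x Bx]; first by case: (HVV i).
  have [i _ Ui] := EU x (AE _ (proj1 Bx)); exists i => //.
  by case: (HVV i) => _ + _; apply.
by apply: lee_nneseries => i *; [exact: measure_ge0|case: (HVV i)].
Qed.
End LocalDimension.

(** * Packing measures and local dimension *)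

Section Packing.
Variables (R : realType) (mu : {measure set KM -> \bar R}).
Hypothesis hmu1 : mu setT = 1%E.

Lemma packing_delta_ge0 (s delta : R) F : (0 <= packing_delta s delta F)%E.
Proof.
apply: ereal_sup_ubound; exists [::]; last by rewrite big_nil.
by split.
Qed.

Lemma packing_pre_ge0 (s : R) F : (0 <= packing_pre s F)%E.
Proof. by apply/ereal_infP => _ [d _ <-]; exact: packing_delta_ge0. Qed.

Lemma packing_measure_ge0 (s : R) F : (0 <= packing_measure s F)%E.
Proof.
apply/ereal_infP => _ [G _ <-]; apply: nneseries_ge0 => i _ _; exact: packing_pre_ge0.
Qed.

Lemma radius_halfX (r : R) N : 0 < r <= 2^-1 ^+ N ->
  exists n, [/\ (N <= n)%N, 2^-1 ^+ n <= r & r <= 2 * 2^-1 ^+ n].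
Proof.
move=> /andP[r0 rN]; have h := halfX_small r0.
case: (ex_minnP h) => n nr nmin; exists n; split=> //.
  by rewrite -(@halfX_le R); exact: le_trans rN.
case: n nr nmin => [|n] nr nmin.
  rewrite expr0 mulr1; apply: (le_trans rN).
  by apply: (@le_trans _ _ (2^-1 ^+ 0)); rewrite ?halfX_le // expr0 ler1n.
have : ~~ ((2^-1 : R) ^+ n <= r) by apply/negP => /nmin; rewrite ltnn.
by rewrite -ltNge exprS mulrA divff ?mul1r // => /ltW.
Qed.

Lemma packing_pre_eq0 (F : set Kt) (s t : R) N : 0 <= t < s ->
  (forall x, F x -> forall n, (N <= n)%N ->
     (((2^-1 ^+ n) `^ t)%:E <= mu (icyl n x))%E) ->
  packing_pre s F = 0%E.
Proof.
move=> /andP[t0 ts] hF.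
have st : 0 < s - t by rewrite subr_gt0.
have s0 : 0 <= s by apply: ltW; exact: le_lt_trans ts.
have /andP[c0 c1] := @powR_half_lt1 R _ st.
apply: (@ge0_le_geometric _ _ (4 `^ s) ((2^-1) `^ (s - t))); first exact: packing_pre_ge0.
  by rewrite c0 c1.
move=> M; apply: (@le_trans _ _ (packing_delta s (2^-1 ^+ (N + M)) F)).
  by apply: ereal_inf_lbound; exists (2^-1 ^+ (N + M)) => //=; exact: halfX_gt0.
apply/ereal_supP => _ [P [PE Pdisj] <-].
have /choice[nb Hnb] : forall b : Kt * R, exists n, b \in P ->
    [/\ (N + M <= n)%N, (2^-1 : R) ^+ n <= b.2 & b.2 <= 2 * 2^-1 ^+ n].
  move=> b; have [bP|] := boolP (b \in P); last by exists 0%N.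
  by have [_ /radius_halfX[n Hn]] := PE b bP; exists n.
pose b0 : Kt * R := (fun=> false, 0).
pose V i : set KM := if (i < size P)%N then icyl (nb (nth b0 P i)) (nth b0 P i).1 else set0.
have mV i : measurable (V i) by rewrite /V; case: ifP => // _; exact: measurable_icyl.
have tV : trivIset setT V.
  move=> i j _ _ [x []]; rewrite /V; case: ifP => // iP; case: ifP => // jP xi xj.
  apply: contrapT => ij; have := Pdisj i j iP jP ij; rewrite -/b0 => /seteqP[+ _].
  apply; split; [move: xi|move: xj]; apply: icyl_ballK.
    by have [] := Hnb (nth b0 P i) (mem_nth _ iP).
  by have [] := Hnb (nth b0 P j) (mem_nth _ jP).
rewrite (big_nth b0) big_mkord.
apply: (@le_trans _ _ (\sum_(i < size P)
    (4 `^ s * (2^-1 `^ (s - t)) ^+ M)%:E * mu (V i))%E).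
  apply: lee_sum => -[i iP] _ /=; rewrite /V iP.
  set b := nth b0 P i; have bP : b \in P by exact: mem_nth.
  have [Nn nb1 nb2] := Hnb b bP; have [Fb /andP[b20 _]] := PE b bP.
  have Nn' : (N <= nb b)%N by exact: leq_trans (leq_addr _ _) Nn.
  apply: (@le_trans _ _ ((4 `^ s * (2^-1 `^ (s - t)) ^+ M)%:E
                         * ((2^-1 ^+ nb b) `^ t)%:E)%E); last first.
    by apply: lee_wpmul2l; [rewrite lee_fin mulr_ge0 ?exprn_ge0 ?powR_ge0|exact: hF].
  rewrite -EFinM lee_fin.
  apply: (@le_trans _ _ ((4 * 2^-1 ^+ nb b) `^ s)).
    apply: ge0_ler_powR => //; rewrite ?nnegrE; [lra| |lra].
    by rewrite mulr_ge0 // ltW // halfX_gt0.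
  rewrite powRM // ?(ltW (halfX_gt0 _ _)) // -mulrA ler_wpM2l ?powR_ge0 //.
  have -> : (2^-1 ^+ nb b) `^ s = (2^-1 ^+ nb b : R) `^ (s - t) * (2^-1 ^+ nb b) `^ t.
    by rewrite -powRD ?subrK // (gt_eqF (halfX_gt0 _ _)) implybT.
  rewrite ler_wpM2r ?powR_ge0 // half_powRX ler_iXn2l //.
  exact: leq_trans (leq_addl _ _) Nn.
rewrite -ge0_sume_distrr; last by move=> i _; exact: measure_ge0.
rewrite -[leRHS]mule1; apply: lee_wpmul2l.
  by rewrite lee_fin mulr_ge0 ?exprn_ge0 ?powR_ge0.
rewrite -(measure_bigsetU mu mV tV) -hmu1; apply: le_measure; rewrite ?inE //.
by apply: bigsetU_measurable => i _.
Qed.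

(** The generation from which the bound holds depends on the point; splitting [E] into countably
    many pieces makes it uniform on each. *)
Lemma packing_measure_eq0 (E : set Kt) (s t : R) : 0 <= t < s ->
  (forall x, E x -> exists N, forall n, (N <= n)%N ->
     (((2^-1 ^+ n) `^ t)%:E <= mu (icyl n x))%E) ->
  packing_measure s E = 0%E.
Proof.
move=> ts hE; apply/eqP; rewrite eq_le packing_measure_ge0 andbT.
pose F N := [set x : Kt | forall n, (N <= n)%N -> (((2^-1 ^+ n) `^ t)%:E <= mu (icyl n x))%E].
apply: ereal_inf_lbound; exists F; first by move=> x /hE[N hN]; exists N.
by apply: eseries0 => N _ _; apply: (@packing_pre_eq0 _ _ t N).
Qed.

(* The first cylinders around the points of [F] where [mu <= 2^-ns] form a packing. *)
Lemma stop_packing (A : set KM) (F : set Kt) (s : R) N : 0 <= s ->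
  (forall x, A x -> exists2 n, (N <= n)%N & (mu (icyl n x) <= ((2^-1 ^+ n) `^ s)%:E)%E) ->
  exists V : set KM, [/\ measurable V, A `&` F `<=` V &
    (mu V <= packing_delta s (2^-1 ^+ N) F)%E].
Proof.
move=> s0 hA.
(* The third condition provides a centre in [F], as a packing of [F] demands. *)
pose Good := [set w : seq bool | [/\ (N <= size w)%N,
  (mu (cyl w) <= ((2^-1 ^+ size w) `^ s)%:E)%E & exists x, F x /\ cyl w x]].
have mU := measurable_stop_cyl Good.
exists (\bigcup_i stop_cyl Good i); split.
- exact: bigcup_measurable.
- move=> x [Ax Fx]; have [n Nn hn] := hA x Ax.
  have [|i ix] := @stop_cyl_cover Good n x; last by exists i.
  by split; rewrite ?size_mkseq //; exists x; split=> //; exact: icyl_refl.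
rewrite (measure_semi_bigcup _ mU (@trivIset_stop_cyl Good)) //; last exact: bigcup_measurable.
apply: nneseries_le_partial => [i|k]; first exact: measure_ge0.
have /choice[phi Hphi] : forall w, exists x, Good w -> F x /\ cyl w x.
  move=> w; have [gw|] := pselect (Good w); last by exists (fun=> false).
  by have [_ _ [x hx]] := gw; exists x.
(* Packings are finite, so each partial sum of the series is compared with the packing given by the
   first words coded below [k]. *)
pose ws := [seq w <- pmap (@pickle_inv (seq bool)) (iota 0 k) | `[< first_word Good w >]].
have wsP w : w \in ws -> first_word Good w by rewrite mem_filter => /andP[/asboolP].
have uws : uniq ws.
  rewrite filter_uniq //; apply: (@pmap_uniq _ _ _ pickle); last exact: iota_uniq.
  exact: pickle_invK.
pose P := [seq (phi w, (2^-1 : R) ^+ size w) | w <- ws].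
apply: (@le_trans _ _ (\sum_(b <- P) ((2 * b.2) `^ s)%:E)%E); last first.
  apply: ereal_sup_ubound; exists P => //; split=> [_ /mapP[w /wsP[gw _] ->]|i j] /=.
    have [Nw _ _] := gw; split; first by case: (Hphi w gw).
    by rewrite halfX_gt0 halfX_le.
  rewrite size_map => iP jP ij; rewrite !(nth_map [::]) //= !ballK_half.
  have [fi fj] := (wsP _ (mem_nth [::] iP), wsP _ (mem_nth [::] jP)).
  apply/seteqP; split=> // x [].
  have E w : first_word Good w -> icyl (size w) (phi w) = cyl w.
    by move=> [/Hphi[_ /cylE ew] _]; rewrite /icyl ew.
  rewrite !E // => xi xj; have := first_word_inj fi fj xi xj => /eqP.
  by rewrite nth_uniq // => /eqP.
rewrite big_map big_filter [leRHS]big_mkcond [leRHS]big_pmap /index_iota subn0.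
apply: lee_sum => i _; rewrite /stop_cyl; case: (pickle_inv i) => [w|] /=; last by rewrite measure0.
case: asboolP => [[[_ gw _] _]|_]; last by rewrite measure0.
apply: (le_trans gw); rewrite lee_fin; apply: ge0_ler_powR => //.
- by rewrite nnegrE ltW // halfX_gt0.
- by rewrite nnegrE mulr_ge0 // ltW // halfX_gt0.
- by have := halfX_gt0 R (size w); lra.
Qed.

(** Each piece of a decomposition of [E] is handled at every scale [2^-N] by [stop_packing];
    intersecting the resulting sets over [N] compares [mu] with the premeasure of that piece. *)
Lemma packing_measure_ge (A E : set KM) (s : R) : 0 <= s -> measurable A -> A `<=` E ->
  (forall x, A x -> forall N, exists2 n, (N <= n)%N &
     (mu (icyl n x) <= ((2^-1 ^+ n) `^ s)%:E)%E) ->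
  (mu A <= packing_measure s E)%E.
Proof.
move=> s0 mA AE hA; apply/ereal_infP => _ [F EF <-].
have HV i : exists V : set KM, [/\ measurable V, A `&` F i `<=` V &
    (mu V <= packing_pre s (F i))%E].
  have /choice[W HW] : forall N, exists V : set KM, [/\ measurable V, A `&` F i `<=` V &
      (mu V <= packing_delta s (2^-1 ^+ N) (F i))%E].
    by move=> N; apply: stop_packing => // x Ax; exact: hA.
  have mW : measurable (\bigcap_N W N).
    by apply: bigcapT_measurable => N; case: (HW N).
  exists (\bigcap_N W N); split=> // [x Ax N _|]; first by case: (HW N) => _ + _; apply.
  apply/ereal_infP => _ [d /= d0 <-]; have [N Nd] := halfX_small d0.
  apply: (@le_trans _ _ (mu (W N))).
    by apply: le_measure; rewrite ?inE //; [case: (HW N)|move=> x; apply].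
  case: (HW N) => _ _ /le_trans; apply.
  apply: ereal_sup_le => _ [P [PE Pd] <-].
  exists P => //; split=> // b /PE[Fb].
  by move=> /andP[b0 bN]; split=> //; rewrite b0 (le_trans bN).
have /choice[V HVV] := HV.
apply: (@le_trans _ _ (\sum_(i <oo) mu (V i))%E).
  apply: measure_sigma_subadditive => // [i|x Ax]; first by case: (HVV i).
  have [i _ Fi] := EF x (AE _ Ax); exists i => //.
  by case: (HVV i) => _ + _; apply.
by apply: lee_nneseries => i *; [exact: measure_ge0|case: (HVV i)].
Qed.
End Packing.

(** * Almost sure behaviour of the information *)

Lemma exists_sqrtn n : exists j, (j ^ 2 <= n < j.+1 ^ 2)%N.
Proof.
elim: n => [|n [j /andP[jn nj]]]; first by exists 0%N.
have [h|h] := leqP (j.+1 ^ 2) n.+1; last by exists j; rewrite h (leq_trans jn).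
exists j.+1; rewrite h /=; apply: (leq_ltn_trans nj).
by rewrite ltn_sqr.
Qed.

Section AlmostSure.
Variables (R : realType) (p q : nat -> R).
Hypothesis hp : forall n, 0 <= p n <= 1.
Hypothesis hq : forall n, 0 <= q n <= 1.
Variable mu : {measure set KM -> \bar R}.
Hypothesis hmu1 : mu setT = 1%E.
Hypothesis hcyl : forall w : seq bool, mu (cyl w) = (markov_cyl p q w)%:E.

Let prob w := word_prob p q 0 false w.
Let H n := word_entropy p q n 0 false.

Lemma mu_cyl w : mu (cyl w) = (prob w)%:E.
Proof. by rewrite hcyl markov_cylE. Qed.

Lemma mu_prefix_le n (P : pred (seq bool)) :
  (mu [set x | P (mkseq x n)] <= (\sum_(w : n.-tuple bool | P w) prob w)%:E)%E.
Proof.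
pose ws := index_enum {: n.-tuple bool}; pose w0 := [tuple of nseq n false].
pose C i : set KM := if P (nth w0 ws i) then cyl (nth w0 ws i) else set0.
have mC i : measurable (C i).
  by rewrite /C; case: ifP => // _; exact: measurable_cyl.
apply: (@le_trans _ _ (\sum_(i < size ws) mu (C i))%E).
  apply: content_subadditive => //; first exact: (measurable_prefix n P).
  move=> x /= Px; rewrite -bigcup_mkord.
  have sz : size (mkseq x n) == n by rewrite size_mkseq.
  exists (index (Tuple sz) ws); first by rewrite /= index_mem mem_index_enum.
  rewrite /C nth_index ?mem_index_enum //= Px.
  exact: icyl_refl.
rewrite -sumEFin [leRHS]big_mkcond [leRHS](big_nth w0) big_mkord.
apply: lee_sum => i _; rewrite /C; case: ifP => _; first by rewrite mu_cyl.
by rewrite measure0.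
Qed.

Lemma H_mono m n : (m <= n)%N -> H m <= H n /\ H n <= H m + 4 * (n - m)%:R.
Proof.
move=> /subnK <-; elim: (n - m)%N => [|k [h1 h2]]; first by rewrite add0n subnn mulr0 addr0.
have := entropyS_bounds hp hq (k + m) 0 false; rewrite -/(H _) -/(H _).
rewrite addSn addnK in h2 *; rewrite -addSn addnK -natr1 => /andP[? ?].
by split; lra.
Qed.

(** The variance is linear in [n] and the threshold is [e * n], so the bound is of order [1 / n]:
    summable along squares. *)
Lemma chebyshev n (e : R) : (0 < n)%N -> 0 < e ->
  (mu [set x | (e * n%:R < `|- ln (prob (mkseq x n)) - H n|)%R] <=
   (52 / e ^+ 2 * n%:R^-1)%:E)%E.
Proof.
move=> n0 e0; apply: (le_trans (mu_prefix_le n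
  (fun w => e * n%:R < `|- ln (prob w) - H n|))).
have en : 0 < e * n%:R by rewrite mulr_gt0 // ltr0n.
rewrite lee_fin; apply: (@le_trans _ _ (word_variance p q n 0 false / (e * n%:R) ^+ 2)).
  rewrite /word_variance big_mkcond /= mulr_suml; apply: ler_sum => w _.
  have /andP[w0 _] := word_prob01 hp hq 0 false w; rewrite -/(prob w) in w0 *.
  case: ifP => [h|_]; last first.
    by apply: divr_ge0; [apply: mulr_ge0 => //; exact: sqr_ge0|exact: sqr_ge0].
  rewrite ler_pdivlMr ?exprn_gt0 // ler_wpM2l // -/(H n).
  rewrite -[leRHS]real_normK ?num_real // ler_sqr ?nnegrE ?normr_ge0 ?ltW //.
have v : word_variance p q n 0 false <= 52 * n%:R.
  have := word_variance_le hp hq n 0 false; set D := _ - _.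
  by have := sqr_ge0 D; lra.
have -> : 52 / e ^+ 2 * n%:R^-1 = 52 * n%:R / (e * n%:R) ^+ 2.
  by field; rewrite pnatr_eq0 -lt0n n0 gt_eqF.
by rewrite ler_pM2r // invr_gt0 exprn_gt0.
Qed.

Lemma sum_inv_sqr_le n : \sum_(0 <= k < n) ((k.+1 ^ 2)%:R : R)^-1 <= 2 - n%:R^-1.
Proof.
elim: n => [|[|n] IH]; first by rewrite big_nil invr0; lra.
  by rewrite big_nat1 exp1n invr1; lra.
rewrite big_nat_recr //=; apply: (le_trans (lerD IH (lexx _))).
have a0 : (0 : R) < n.+1%:R by rewrite ltr0n.
rewrite natrX -[n.+2%:R]natr1; set a := n.+1%:R in a0 *.
(* Partial fractions: the sum of inverse squares is compared with a telescoping one. *)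
have -> : a^-1 = (a * (a + 1))^-1 + (a + 1)^-1.
  by field; apply/andP; split; apply: lt0r_neq0; lra.
have : ((a + 1) ^+ 2)^-1 <= (a * (a + 1))^-1.
  by rewrite lef_pV2 ?posrE ?exprn_gt0 ?mulr_gt0 //; [nra|lra|lra].
by move: (_^-1) (_^-1) (_^-1) => x y z; lra.
Qed.

Lemma ae_subsequence (e : R) : 0 < e ->
  exists Z : set KM, [/\ measurable Z, mu Z = 0%E & forall x, ~ Z x ->
    exists N, forall k, (N <= k)%N ->
      `|- ln (prob (mkseq x (k.+1 ^ 2))) - H (k.+1 ^ 2)| <= e * (k.+1 ^ 2)%:R].
Proof.
move=> e0.
pose F k : set KM := [set x | e * (k.+1 ^ 2)%:R <
   `|- ln (prob (mkseq x (k.+1 ^ 2))) - H (k.+1 ^ 2)|].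
have mF k : measurable (F k).
  exact: (measurable_prefix _ [set w | is_true (e * (k.+1 ^ 2)%:R <
    `|- ln (prob w) - H (k.+1 ^ 2)|)]).
exists (lim_sup_set F); split.
- apply: bigcap_measurableType => k _; apply: bigcup_measurable => j _; exact: mF.
- apply: lim_sup_set_cvg0 => //.
  apply: (@le_lt_trans _ _ (52 / e ^+ 2 * 2)%:E); last exact: ltry.
  apply: nneseries_le_partial => [k|n]; first exact: measure_ge0.
  apply: (@le_trans _ _ (\sum_(0 <= k < n) (52 / e ^+ 2 * ((k.+1 ^ 2)%:R)^-1)%:E)%E).
    by apply: lee_sum => k _; apply: chebyshev => //; rewrite expn_gt0.
  rewrite sumEFin lee_fin -mulr_sumr ler_wpM2l ?divr_ge0 ?sqr_ge0 //.
  by apply: (le_trans (sum_inv_sqr_le n)); rewrite lerBlDr lerDl invr_ge0.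
move=> x /existsNP[N /not_implyP[_ h]]; exists N => k Nk; rewrite leNgt; apply/negP => Fk.
by apply: h; exists k.
Qed.

(** Since [ln 0] is 0, [- ln prob] is monotone in the length only along points all of whose prefixes
    have positive probability. *)
Lemma ae_prob_gt0 : exists Z : set KM, [/\ measurable Z, mu Z = 0%E &
  forall x, ~ Z x -> forall n, 0 < prob (mkseq x n)].
Proof.
pose B n : set KM := [set x | prob (mkseq x n) == 0].
have mB n : measurable (B n) by exact: (measurable_prefix _ [set w | is_true (prob w == 0)]).
have B0 n : mu (B n) = 0%E.
  apply/eqP; rewrite eq_le measure_ge0 andbT.
  apply: (le_trans (mu_prefix_le n (fun w => prob w == 0))).
  by rewrite big1 // => w /eqP.
exists (\bigcup_n B n); split; first exact: bigcup_measurable.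
  apply/eqP; rewrite eq_le measure_ge0 andbT.
  apply: (le_trans (measure_sigma_subadditive mu mB _ (@subset_refl _ _))).
    exact: bigcup_measurable.
  by rewrite eseries0 // => n _ _; exact: B0.
move=> x nBx n; rewrite lt_neqAle eq_sym; have /andP[-> _] := word_prob01 hp hq 0 false (mkseq x n).
by rewrite andbT; apply/negP => h; apply: nBx; exists n.
Qed.

Lemma prob_mono x m n : (m <= n)%N -> prob (mkseq x n) <= prob (mkseq x m).
Proof.
move=> /subnK <-; elim: (n - m)%N => [|k IH]; first by rewrite add0n.
apply: le_trans IH; rewrite addSn /mkseq -addn1 iotaD map_cat cats1 add0n.
exact: word_prob_rcons_le.
Qed.

(* [- ln prob] and [H] are monotone and [H] has bounded increments, so the values at the squares
   control everything. *)
Lemma ae_information (e : R) : 0 < e ->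
  exists Z : set KM, [/\ measurable Z, mu Z = 0%E & forall x, ~ Z x ->
    exists N, forall n, (N <= n)%N -> 0 < prob (mkseq x n) /\
      `|- ln (prob (mkseq x n)) - H n| <= e * n%:R].
Proof.
(* Since [(k + 2)^2 <= 4 (k + 1)^2], the deviation at the upper square costs at most four fifths of
   [e * (k + 1)^2]; the entropy increment between the squares costs the fifth one. *)
move=> e0; have e5 : 0 < e / 5 by rewrite divr_gt0.
have [Z1 [mZ1 Z10 h1]] := ae_subsequence e5.
have [Z2 [mZ2 Z20 h2]] := ae_prob_gt0.
exists (Z1 `|` Z2); split; first exact: measurableU.
  by rewrite measureU0.
move=> x /not_orP[/h1[N hN] /h2 px].
(* The first bound lets [hN] apply at both squares around [n]; the second makes the entropy
   increment [4 * (2 * j + 1) <= 12 * j] at most [e / 5 * j ^ 2]. *)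
pose J := maxn N.+1 (Num.truncn (60 / e)).+1.
have HJ j : (J <= j)%N -> 12 * (j%:R : R) <= e / 5 * (j ^ 2)%:R.
  rewrite geq_max => /andP[_ h]; have : 60 / e <= j%:R.
    apply: ltW; apply: (lt_le_trans (truncnS_gt _)); by rewrite ler_nat.
  rewrite ler_pdivrMr // natrX expr2 => h60.
  have : j%:R * 60 <= j%:R * (j%:R * e) :> R by rewrite ler_wpM2l.
  by lra.
exists (J.+1 ^ 2)%N => n Jn; split=> //.
have [j /andP[jn nj]] := exists_sqrtn n.
have Jj : (J <= j)%N.
  by move: (leq_ltn_trans Jn nj); rewrite ltn_sqr ltnS => /ltnW.
have := HJ j Jj; move: Jj; rewrite geq_max => /andP[Nj _] h12.
case: j => [//|k] in jn nj Nj h12 *.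
have k1 : (1 : R) <= k.+1%:R by rewrite ler1n.
have := hN k Nj; have := hN k.+1 (leqW Nj).
have lnmono a b : (a <= b)%N -> - ln (prob (mkseq x a)) <= - ln (prob (mkseq x b)).
  by move=> ab; rewrite lerN2 ler_ln ?posrE ?px // prob_mono.
have := lnmono _ _ jn; have := lnmono _ _ (ltnW nj).
have [Hkn _] := H_mono jn; have [Hnk _] := H_mono (ltnW nj).
have [_] := H_mono (leq_trans jn (ltnW nj)).
have jnR : (k.+1 ^ 2)%:R <= n%:R :> R by rewrite ler_nat.
have -> : (k.+2 ^ 2 - k.+1 ^ 2)%:R = 2 * k.+1%:R + 1 :> R.
  by rewrite natrB ?leq_sqr // !natrX -[k.+2%:R]natr1; ring.
have e2 : (k.+2 ^ 2)%:R = (k.+1 ^ 2)%:R + 2 * k.+1%:R + 1 :> R.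
  by rewrite !natrX -[k.+2%:R]natr1; ring.
rewrite e2; have k2 : (k.+1 ^ 2)%:R >= k.+1%:R :> R by rewrite ler_nat -mulnn leq_pmulr.
move: h12 jnR k2 k1; set L0 := ln _; set L1 := ln _; set L := ln _.
set S := (k.+1 ^ 2)%:R; set c := k.+1%:R => h12 jnR k2 k1 Hinc Lub Llb.
rewrite !ler_norml => /andP[a1 a2] /andP[b1 b2].
have eS : e * S <= e * n%:R by rewrite ler_pM2l.
have ec : e * c <= e * S by rewrite ler_pM2l.
have ek : e <= e * c by rewrite ler_pMr.
by apply/andP; split; lra.
Qed.

End AlmostSure.

(** * Dimensions of the measure *)

Section Dimensions.
Variables (R : realType) (p q : nat -> R).
Hypothesis hp : forall n, 0 <= p n <= 1.
Hypothesis hq : forall n, 0 <= q n <= 1.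
Variable mu : {measure set KM -> \bar R}.
Hypothesis hmu1 : mu setT = 1%E.
Hypothesis hcyl : forall w : seq bool, mu (cyl w) = (markov_cyl p q w)%:E.

Let prob w := word_prob p q 0 false w.
Let H n := word_entropy p q n 0 false.

Let ln2_gt0 : 0 < ln 2 :> R.
Proof. by rewrite ln_gt0 // ltr1n. Qed.

Lemma entropy_nE n : entropy_n mu n = H n / (n%:R * ln 2).
Proof.
rewrite /entropy_n /H /word_entropy sumrN; congr (- _ / _).
by apply: eq_bigr => w _; rewrite hcyl markov_cylE.
Qed.

Lemma entropy_n_ge0 n : 0 <= entropy_n mu n.
Proof.
rewrite entropy_nE divr_ge0 ?mulr_ge0 // ?(ltW ln2_gt0) //.
apply: sumr_ge0 => w _; rewrite xlogxE; apply: Nmulr_ln_ge0.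
exact: word_prob01.
Qed.

Lemma h_lower_ge0 : (0 <= h_lower mu)%E.
Proof.
rewrite leNgt; apply/negP => /limn_einf_lt/(_ 0%N)[n _].
by rewrite lte_fin ltNge entropy_n_ge0.
Qed.

Lemma h_upper_ge0 : (0 <= h_upper mu)%E.
Proof. exact: le_trans h_lower_ge0 (limn_einf_sup _). Qed.

Let typical (e : R) (x : Kt) n :=
  0 < prob (mkseq x n) /\ `|- ln (prob (mkseq x n)) - H n| <= e * n%:R.

(** The information is at most [H n] plus the deviation, hence below [u * n * ln 2 + (t - u) * n *
    ln 2 = t * n * ln 2]. *)
Lemma mu_icyl_ge (u t : R) x n : (0 < n)%N -> entropy_n mu n < u ->
  typical ((t - u) * ln 2) x n -> (((2^-1 ^+ n) `^ t)%:E <= mu (icyl n x))%E.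
Proof.
move=> n0; rewrite entropy_nE ltr_pdivrMr ?mulr_gt0 ?ltr0n // => Hu [px].
rewrite ler_norml => /andP[_ h]; rewrite (mu_cyl hcyl) -/(prob _) lee_fin halfX_powR.
by rewrite -[leRHS]lnK ?posrE // ler_expR; lra.
Qed.

Lemma mu_icyl_le (u t : R) x n : (0 < n)%N -> u < entropy_n mu n ->
  typical ((u - t) * ln 2) x n -> (mu (icyl n x) <= ((2^-1 ^+ n) `^ t)%:E)%E.
Proof.
move=> n0; rewrite entropy_nE ltr_pdivlMr ?mulr_gt0 ?ltr0n // => Hu [px].
rewrite ler_norml => /andP[h _]; rewrite (mu_cyl hcyl) -/(prob _) lee_fin halfX_powR.
by rewrite -[leLHS]lnK ?posrE // ler_expR; lra.
Qed.

Let ae_typical (e : R) : 0 < e -> exists Z : set KM, [/\ measurable Z, mu Z = 0%E &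
  forall x, ~ Z x -> exists N, forall n, (N <= n)%N -> typical e x n].
Proof. exact: ae_information. Qed.

Lemma mu_setD_gt0 (E Z : set KM) : measurable E -> measurable Z -> mu Z = 0%E ->
  (0 < mu E)%E -> (0 < mu (E `\` Z))%E.
Proof.
move=> mE mZ Z0 /lt_le_trans; apply.
have mD : measurable (E `\` Z) by exact: measurableD.
apply: (@le_trans _ _ (mu ((E `\` Z) `|` Z))).
  apply: le_measure; rewrite ?inE //; first exact: measurableU.
  by move=> x Ex; have [Zx|Zx] := pselect (Z x); [right|left].
by rewrite -[leRHS]adde0 -[in leRHS]Z0; exact: measureU2.
Qed.

Lemma dim_upper_le : (dim_upper mu <= h_lower mu)%E.
Proof.
apply: le_of_lt_EFin => s /lt_between[u /andP[hu]]; rewrite lte_fin => us.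
have u0 : 0 <= u by rewrite -lee_fin; exact: le_trans h_lower_ge0 (ltW hu).
pose t := (u + s) / 2; have [ut ts] : u < t /\ t < s by rewrite /t; split; lra.
have [|Z [mZ Z0 hZ]] := @ae_typical ((t - u) * ln 2).
  by rewrite mulr_gt0 ?subr_gt0.
(* Defined by the measure bound alone, this set is measurable and all of its points satisfy the
   criterion of [hausdorff_eq0]; it contains the complement of [Z]. *)
pose E : set KM := lim_sup_set (fun n =>
  [set x | [set w | (((2^-1 ^+ n) `^ t)%:E <= mu (cyl w))%E] (mkseq x n)]).
have mE : measurable E.
  by apply: bigcap_measurableType => k _; apply: bigcup_measurable => n _;
    exact: measurable_prefix.
apply: (@le_trans _ _ (dimH R E)).
  apply: ereal_inf_lbound; exists E => //; split=> //.
  apply: subset_measure0 mZ _ Z0; first exact: measurableC.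
  move=> x nE; apply: contrapT => /hZ[N hN]; apply: nE => k _.
  (* Using [k.+1] makes [n] positive, as the division by [n] in [entropy_n] requires. *)
  have [n kn Hn] := limn_einf_lt hu (maxn N k.+1).
  move: kn; rewrite geq_max => /andP[Nn kn].
  exists n; first exact: ltnW.
  by apply: (@mu_icyl_ge u) => //; [exact: leq_ltn_trans kn|exact: hN].
apply: ereal_inf_lbound; exists s => //; split; first by lra.
apply: (hausdorff_eq0 hmu1 (t := t)); first by rewrite ts andbT; lra.
by move=> x Ex N; have [n Nn hn] := Ex N I; exists n.
Qed.

Lemma dim_lower_ge : (h_lower mu <= dim_lower mu)%E.
Proof.
apply/ereal_infP => _ [E [mE E0] <-]; apply/ereal_infP => _ [s [s0 sE] <-].
rewrite leNgt; apply/negP => /lt_between[u /andP[]]; rewrite lte_fin => su uh.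
have [|Z [mZ Z0 hZ]] := @ae_typical ((u - s) * ln 2).
  by rewrite mulr_gt0 ?subr_gt0.
suff : (0 < hausdorff s E)%E by rewrite sE ltxx.
apply: (hausdorff_gt0 hmu1 (A := E `\` Z)) => //; first exact: measurableD.
  exact: mu_setD_gt0.
move=> x [_ /hZ[N hN]]; have [M hM] := limn_einf_gt uh.
exists (maxn N M.+1) => n; rewrite geq_max => /andP[Nn Mn].
apply: (@mu_icyl_le u) => //; first exact: leq_ltn_trans Mn.
  by rewrite -lte_fin; exact: hM (ltnW Mn).
exact: hN.
Qed.

Lemma Dim_upper_le : (Dim_upper mu <= h_upper mu)%E.
Proof.
apply: le_of_lt_EFin => s /lt_between[u /andP[hu]]; rewrite lte_fin => us.
have u0 : 0 <= u by rewrite -lee_fin; exact: le_trans h_upper_ge0 (ltW hu).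
pose t := (u + s) / 2; have [ut ts] : u < t /\ t < s by rewrite /t; split; lra.
have [|Z [mZ Z0 hZ]] := @ae_typical ((t - u) * ln 2).
  by rewrite mulr_gt0 ?subr_gt0.
apply: (@le_trans _ _ (dimP R (~` Z))).
  apply: ereal_inf_lbound; exists (~` Z) => //; split; first exact: measurableC.
  by rewrite setCK.
apply: ereal_inf_lbound; exists s => //; split; first by lra.
apply: (packing_measure_eq0 hmu1 (t := t)); first by rewrite ts andbT; lra.
move=> x /hZ[N hN]; have [M hM] := limn_esup_lt hu.
exists (maxn N M.+1) => n; rewrite geq_max => /andP[Nn Mn].
apply: (@mu_icyl_ge u) => //; first exact: leq_ltn_trans Mn.
  by rewrite -lte_fin; exact: hM (ltnW Mn).
exact: hN.
Qed.

(** An exponent [s] below [h_upper] makes the measure of cylinders small only at infinitely many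
    generations, which is all that [packing_measure_ge] asks for. *)
Lemma Dim_lower_ge : (h_upper mu <= Dim_lower mu)%E.
Proof.
apply/ereal_infP => _ [E [mE E0] <-]; apply/ereal_infP => _ [s [s0 sE] <-].
rewrite leNgt; apply/negP => /lt_between[u /andP[]]; rewrite lte_fin => su uh.
have [|Z [mZ Z0 hZ]] := @ae_typical ((u - s) * ln 2).
  by rewrite mulr_gt0 ?subr_gt0.
have : (mu (E `\` Z) <= packing_measure s E)%E.
  apply: packing_measure_ge => //; first exact: measurableD.
  move=> x [_ /hZ[N hN]] k; have [n kn Hn] := limn_esup_gt uh (maxn N k.+1).
  move: kn; rewrite geq_max => /andP[Nn kn].
  exists n; first exact: ltnW.
  by apply: (@mu_icyl_le u) => //; [exact: leq_ltn_trans kn|exact: hN].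
by rewrite sE leNgt mu_setD_gt0.
Qed.

Lemma ereal_inf_full_ge (f : set KM -> \bar R) :
  (ereal_inf [set f E | E in [set E : set KM | measurable E /\ (0 < mu E)%E]] <=
   ereal_inf [set f E | E in [set E : set KM | measurable E /\ mu (~` E) = 0%E]])%E.
Proof.
apply/ereal_infP => _ [E [mE E0] <-]; apply: ereal_inf_lbound; exists E => //; split=> //.
(* A set of full measure has positive measure because the total mass is 1. *)
by rewrite -[E]setCK -setTD; apply: mu_setD_gt0 => //; [exact: measurableC|rewrite hmu1].
Qed.

End Dimensions.

Theorem theorem1 (R : realType) (p q : nat -> R)
  (hp : forall n, 0 <= p n <= 1) (hq : forall n, 0 <= q n <= 1)
  (mu : {measure set KM -> \bar R})
  (hmu1 : mu setT = 1%E)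
  (hcyl : forall w : seq bool, mu (cyl w) = (markov_cyl p q w)%:E) :
  dim_lower mu = h_lower mu /\ dim_upper mu = h_lower mu /\
  Dim_lower mu = h_upper mu /\ Dim_upper mu = h_upper mu.
Proof.
have dl := dim_lower_ge hp hq hmu1 hcyl.
have du := dim_upper_le hp hq hmu1 hcyl.
have Dl := Dim_lower_ge hp hq hcyl.
have Du := Dim_upper_le hp hq hmu1 hcyl.
have d := ereal_inf_full_ge hmu1 (dimH R).
have D := ereal_inf_full_ge hmu1 (dimP R).
(* Each equality closes a cycle: entropy bound, lower dimension, upper dimension, entropy bound. *)
split; last split; last split; apply/eqP; rewrite eq_le.
- by rewrite dl (le_trans d du).
- by rewrite du (le_trans dl d).
- by rewrite Dl (le_trans D Du).
- by rewrite Du (le_trans Dl D).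
Qed.
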